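(* Let $G$ be a finite group which is nilpotent of class $\leq 2$, with centre $Z$ and $\bar G=G/Z$ (an abelian group). Let $\rho:G\to \mathrm{GL}(V)$ be an irreducible representation of dimension $s$ on a complex vector space $V$, unitary with respect to a positive-definite Hermitian form $\langle\cdot,\cdot\rangle$ on $V$, with central character $\psi:Z\to\mathbb{C}^\times$. Let $\mathcal{Y}$ be a $G$-bouquet and let $\mathfrak{a}_{\mathcal{Y}}:\bar G\to[0,1]$ be its angle-map. Define $\Upsilon_\psi:\mathcal{M}(\bar G)\to\mathcal{M}(\bar G)$ by $\Upsilon_\psi(F)(\gamma')=\sum_{\gamma\in\bar G}\psi(\delta_G(\gamma,\gamma'))F(\gamma)$. Then the function $\mathfrak{a}_{\mathcal{Y}}^2\in\mathcal{M}(\bar G)$ is an eigenvector of $\Upsilon_\psi$ with eigenvalue $|\bar G|/s$, i.e. $\Upsilon_\psi(\mathfrak{a}_{\mathcal{Y}}^2)=(|\bar G|/s)\,\mathfrak{a}_{\mathcal{Y}}^2$.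
   Context: Hermitian forms are conjugate-linear in the first variable. The central character $\psi$ is defined by $\rho(z)=\psi(z)\mathrm{id}_V$ for $z\in Z$. The group $\bar G$ acts on the set $\mathbb{P}V$ of complex lines in $V$ by $\bar g\cdot \mathbb{C}v=\mathbb{C}(\rho(g)v)$; a $G$-bouquet is an orbit of this action. For lines $\ell,\ell'$, the angle $\mathfrak{a}(\ell,\ell')=|\langle v,v'\rangle|$ for unit vectors $v\in\ell$, $v'\in\ell'$. For $\ell\in\mathcal{Y}$, $\mathfrak{a}_\ell(\gamma)=\mathfrak{a}(\ell,\gamma\cdot\ell)$ for $\gamma\in\bar G$; for nilpotent $G$ of class $\le 2$ this function does not depend on the choice of $\ell\in\mathcal{Y}$ and is denoted $\mathfrak{a}_{\mathcal{Y}}$. $\mathcal{M}(\bar G)$ denotes the complex vector space of all functions $\bar G\to\mathbb{C}$. The map $\delta_G:\bar G\times\bar G\to Z$ is $\delta_G(\bar g_1,\bar g_2)=g_1g_2g_1^{-1}g_2^{-1}$. *)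

(* Defs.v *)
From HB Require Import structures.
From mathcomp Require Import boolp classical_sets reals.
From mathcomp Require Import all_boot all_order all_algebra all_fingroup all_solvable.
From mathcomp Require Import sesquilinear.

Set Implicit Arguments.
Unset Strict Implicit.
Unset Printing Implicit Defensive.

Import Order.TTheory GRing.Theory Num.Theory GroupScope.
Local Open Scope ring_scope.

(* The finite group G is a whole [finGroupType], so that the type
   [coset_of 'Z([set: gT])] is exactly the set of all cosets of the centre. *)
Notation Gbar gT := (coset_of 'Z([set: gT])).

(* Some lift of an element of G / Z to G; all functions on G / Z below are
   given through this lift, and shown not to depend on it. *)
Definition lift_bar (gT : finGroupType) (c : Gbar gT) : gT := repr c.

(* The map delta_G; with the conventions of the library this is
   [~ g1^-1, g2^-1]. *)
Definition delta_bar (gT : finGroupType) (c1 c2 : Gbar gT) : gT :=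
  (lift_bar c1 * lift_bar c2 * (lift_bar c1)^-1 * (lift_bar c2)^-1)%g.

(* The functions G / Z -> C; [C^o] is C as a module over itself. *)
Notation Mbar gT C := {ffun Gbar gT -> C^o}.

Section Representation.
Variables (gT : finGroupType) (C : numClosedFieldType) (V : vectType C).
Implicit Types (rho : gT -> 'End(V)) (psi : gT -> C) (l : {vspace V}).

(* These two conditions force each [rho g] to be invertible. *)
Definition is_representation rho : Prop :=
  rho 1%g = \1%VF /\ forall g h, rho (g * h)%g = (rho g \o rho h)%VF.

Definition is_irreducible rho : Prop :=
  (0 < \dim {:V})%N /\
  forall U : {vspace V},
    (forall g, (rho g @: U <= U)%VS) -> U = 0%VS \/ U = fullv.

(* Library forms are linear in the first variable and conjugate-linear in the
   second; the bracket used here is conjugate-linear in the first one. *)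
Definition bracket (form : {dot V for Num.conj}) (u v : V) : C := form v u.

Definition is_unitary_rep (form : {dot V for Num.conj}) rho : Prop :=
  forall g u v, bracket form (rho g u) (rho g v) = bracket form u v.

(* Only the values of psi on the centre are meaningful. *)
Definition is_central_character rho psi : Prop :=
  forall z, z \in 'Z([set: gT]) -> rho z = psi z *: \1%VF.

Definition is_line l : Prop := \dim l = 1%N.

Definition line_act rho (c : Gbar gT) l : {vspace V} :=
  (rho (lift_bar c) @: l)%VS.

Definition is_bouquet rho (Y : set {vspace V}) : Prop :=
  exists2 l, is_line l & Y = range (fun c => line_act rho c l).

(* "The" value of |<v, v'>| for unit vectors v in l and v' in l'. *)
Definition angle (form : {dot V for Num.conj}) (l l' : {vspace V}) : C :=
  xget 0 [set a : C | exists v v', [/\ v \in l, v' \in l',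
     bracket form v v = 1, bracket form v' v' = 1
     & a = `|bracket form v v'| ] ]%classic.

Definition line_angle_map form rho l (c : Gbar gT) : C :=
  angle form l (line_act rho c l).

(* The angle map of a bouquet, computed at some line of it. *)
Definition angle_map form rho (Y : set {vspace V}) (c : Gbar gT) : C :=
  line_angle_map form rho (xget 0%VS Y) c.

Definition Upsilon psi (F : Mbar gT C) : Mbar gT C :=
  [ffun c' => \sum_(c : Gbar gT) psi (delta_bar c c') * F c].

Definition angle_map_sq form rho (Y : set {vspace V}) : Mbar gT C :=
  [ffun c => angle_map form rho Y c ^+ 2].

End Representation.

Section GroupFacts.
Variable gT : finGroupType.
Implicit Types (g : gT) (c : Gbar gT).
Let Z := 'Z([set: gT]).

Lemma lift_barK c : coset Z (lift_bar c) = c.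
Proof. exact: coset_reprK. Qed.

Lemma lift_bar_coset g : exists2 z, z \in Z & lift_bar (coset Z g) = (z * g)%g.
Proof.
have gN : g \in 'N(Z).
  have /subsetP := normal_norm (center_normal [set: gT]%G).
  by apply; rewrite inE.
have : lift_bar (coset Z g) \in Z :* g.
  by rewrite -val_coset // mem_repr_coset.
by case/rcosetP => z zZ ->; exists z.
Qed.

Lemma centralZ z g : z \in Z -> (z * g = g * z)%g.
Proof. by case/centerP => _ /(_ g); apply; rewrite inE. Qed.

Lemma delta_bar_coset g1 g2 :
  delta_bar (coset Z g1) (coset Z g2) = (g1 * g2 * g1^-1 * g2^-1)%g.
Proof.
rewrite /delta_bar.
have [z1 z1Z ->] := lift_bar_coset g1; have [z2 z2Z ->] := lift_bar_coset g2.
have cz1 g := centralZ g z1Z; have cz2 g := centralZ g z2Z.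
rewrite !invMg (cz1 g1) (cz2 g2) -!mulgA; congr (_ * _)%g.
rewrite cz1 -!mulgA; congr (_ * _)%g.
rewrite cz2 -!mulgA; congr (_ * _)%g.
by rewrite (cz1 z2) mulKg -cz1 mulKg.
Qed.

Lemma delta_bar_center c1 c2 :
  nilpotent [set: gT] -> (nil_class [set: gT] <= 2)%N -> delta_bar c1 c2 \in Z.
Proof.
move=> nilG /(lcn_nil_classP 2 nilG) L3.
have sub : [~: [set: gT], [set: gT]] \subset Z.
  by rewrite subsetI subsetT; apply/commG1P.
have -> : delta_bar c1 c2 = [~ (lift_bar c1)^-1, (lift_bar c2)^-1]%g.
  by rewrite /delta_bar commgEl /conjg !invgK !mulgA.
by apply: (subsetP sub); rewrite mem_commg ?inE.
Qed.

End GroupFacts.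

Section RepresentationFacts.
Variables (gT : finGroupType) (C : numClosedFieldType) (V : vectType C).
Variables (form : {dot V for Num.conj}) (rho : gT -> 'End(V)) (psi : gT -> C).
Implicit Types (l : {vspace V}) (c : Gbar gT) (g h z : gT) (u v : V).
Let Z := 'Z([set: gT]).

Lemma bracketZ a b u v :
  bracket form (a *: u) (b *: v) = a^* * b * bracket form u v.
Proof. by rewrite /bracket linearZl_LR /= linearZr_LR /= mulrCA mulrA. Qed.

Lemma bracket_gt0 u : u != 0 -> 0 < bracket form u u.
Proof. exact: neq0_dnorm_gt0. Qed.

Lemma lineP l : is_line l -> exists2 v, v != 0 & l = <[v]>%VS.
Proof.
move=> l1; have l0 : l != 0%VS by rewrite -dimv_eq0 l1.
exists (vpick l); first by rewrite vpick0.
by apply/esym/eqP; rewrite eqEdim -memvE memv_pick dim_vline vpick0 l0 l1.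
Qed.

Lemma line_unit l : is_line l -> exists2 v, v \in l & bracket form v v = 1.
Proof.
case/lineP => v v0 ->; have nv := bracket_gt0 v0.
exists ((sqrtC (bracket form v v))^-1 *: v); first by rewrite memvZ ?memv_line.
have s0 : 0 < sqrtC (bracket form v v) by rewrite sqrtC_gt0.
rewrite bracketZ conj_Creal ?realV ?gtr0_real // -invfM -expr2 sqrtCK.
by rewrite mulVf // gt_eqF.
Qed.

Lemma angleE l l' v v' : is_line l -> is_line l' -> v \in l -> v' \in l' ->
  bracket form v v = 1 -> bracket form v' v' = 1 ->
  angle form l l' = `|bracket form v v'|.
Proof.
move=> /lineP[w w0 ->] /lineP[w' w'0 ->] /vlineP[a ->] /vlineP[a' ->] n1 n1'.
rewrite /angle; case: xgetP => [x _|/(_ `|bracket form (a *: w) (a' *: w')|)].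
  case=> u [u' [/vlineP[b ->] /vlineP[b' ->] m1 m1' ->]].
  have aux t1 t2 t (t0 : t != 0) : bracket form (t1 *: t) (t1 *: t) = 1 ->
      bracket form (t2 *: t) (t2 *: t) = 1 -> `|t1| = `|t2|.
    rewrite !bracketZ => <- /eqP; rewrite (inj_eq (mulIf _)); last first.
      by rewrite gt_eqF // bracket_gt0.
    rewrite ![_^* * _]mulrC -!normCK eqrXn2 // => /eqP //.
  by rewrite !bracketZ !normrM !norm_conjC (aux a b w) // (aux a' b' w').
case; exists (a *: w), (a' *: w').
by split; rewrite ?memvZ ?memv_line.
Qed.

Lemma angle_itv l l' : is_line l -> is_line l' -> 0 <= angle form l l' <= 1.
Proof.
move=> ll ll'; have [v vl v1] := line_unit ll; have [v' vl' v1'] := line_unit ll'.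
rewrite (angleE ll ll' vl vl' v1 v1') normr_ge0 /=.
have [le1 _] := CauchySchwarz_sqrt form v' v.
by move: le1; rewrite -![form _ _]/(bracket form _ _) v1 v1' sqrtC1 mulr1.
Qed.

Lemma Upsilon_is_linear : linear (@Upsilon gT C psi).
Proof.
move=> a F1 F2; apply/ffunP => c'; rewrite !ffunE scaler_sumr -big_split /=.
by apply: eq_bigr => c _; rewrite !ffunE mulrDr [a *: (_ * _)]mulrCA.
Qed.

Hypotheses (rho_repr : is_representation rho) (rhoU : is_unitary_rep form rho).
Hypothesis rho_psi : is_central_character rho psi.

Lemma rhoM g h v : rho (g * h)%g v = rho g (rho h v).
Proof. by rewrite rho_repr.2 comp_lfunE. Qed.

Lemma rho_eq0 g v : (rho g v == 0) = (v == 0).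
Proof.
apply/eqP/eqP => [e|->]; last exact: linear0.
have := rhoM g^-1 g v; rewrite mulVg rho_repr.1 id_lfunE e => ->.
exact: linear0.
Qed.

Lemma psi_neq0 z v : v != 0 -> z \in Z -> psi z != 0.
Proof.
move=> v0 /rho_psi e; apply: contra v0 => /eqP p0.
by rewrite -(rho_eq0 z) e p0 scale0r zero_lfunE.
Qed.

Lemma rho_line g v : (rho g @: <[v]> = <[rho g v]>)%VS.
Proof. exact: limg_line. Qed.

Lemma line_act_coset g v :
  line_act rho (coset Z g) <[v]>%VS = <[rho g v]>%VS.
Proof.
have [->|v0] := eqVneq v 0.
  by rewrite /line_act rho_line !linear0.
rewrite /line_act rho_line; have [z zZ ->] := lift_bar_coset g.
rewrite rhoM rho_psi // scale_lfunE id_lfunE.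
have p0 := psi_neq0 v0 zZ.
apply/eqP; rewrite eqEdim !dim_vline scaler_eq0 (negPf p0) leqnn andbT.
by rewrite -memvE memvZ ?memv_line.
Qed.

Lemma is_line_act c l : is_line l -> is_line (line_act rho c l).
Proof.
by case/lineP => v v0 ->; rewrite /is_line /line_act rho_line dim_vline rho_eq0 v0.
Qed.

Lemma line_angle_map_indep (Y : set {vspace V}) l l' :
  nilpotent [set: gT] -> (nil_class [set: gT] <= 2)%N ->
  is_bouquet rho Y -> Y l -> Y l' ->
  line_angle_map form rho l =1 line_angle_map form rho l'.
Proof.
move=> nilG cl2 [l0 l01 ->].
suff H d : line_angle_map form rho (line_act rho d l0) =1
           line_angle_map form rho l0.
  by move=> [d _ <-] [d' _ <-] c; rewrite !H.
move=> c; rewrite /line_angle_map.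
have [v vl v1] := line_unit l01.
have nz (u : V) : bracket form u u = 1 -> u != 0.
  move=> u1; apply/eqP => u0; move: u1; rewrite u0 /bracket linear0l => /esym/eqP.
  by rewrite oner_eq0.
pose g := lift_bar c; pose h := lift_bar d.
have rv k l1 u : u \in l1 -> rho (lift_bar k) u \in line_act rho k l1.
  by move=> ?; rewrite memv_img.
rewrite (@angleE _ _ (rho h v) (rho g (rho h v))) ?rhoU //; first last.
- by rewrite !rv.
- by rewrite rv.
- exact/is_line_act/is_line_act.
- exact: is_line_act.
rewrite (@angleE _ _ v (rho g v)) ?rhoU ?rv //; last exact: is_line_act.
have dZ := delta_bar_center c d nilG cl2.
have -> : rho g (rho h v) = psi (delta_bar c d) *: rho h (rho g v).
  rewrite -[rho h (rho g v)]id_lfunE -scale_lfunE -rho_psi // -!rhoM.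
  by rewrite /delta_bar -/g -/h !mulgA mulgKV mulgKV.
have := rhoU (delta_bar c d) v v; rewrite rho_psi // scale_lfunE id_lfunE.
rewrite v1 bracketZ v1 mulr1 mulrC -normCK => /eqP.
rewrite -[RHS in _ == RHS](expr1n _ 2) eqrXn2 // => /eqP p1.
rewrite -[rho h v]scale1r bracketZ conjC1 mul1r rhoU normrM p1.
by rewrite mul1r.
Qed.

End RepresentationFacts.

(* Main.v *)
(* Let [v] be a unit vector of a line of the bouquet, [h] a lift of [c'] and
   [w = rho(h)^-1 v]. By unitarity
   [psi(delta(g, h)) <rho(g) v, v> = <rho(g) w, w>], so that
   [Upsilon(a^2)(c') = sum_g <v, rho(g) v> <rho(g) w, w>], and Schur
   orthogonality over G / Z evaluates this as [|G / Z| / s * |<v, w>|^2], where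
   [|<v, w>| = |<v, rho(h) v>|]. Schur orthogonality is the fact that
   [sum_g rho(g) f rho(g)^-1] commutes with [rho], hence is the scalar
   [|G / Z| / s * tr f], applied to rank one operators [f]. *)
From HB Require Import structures.
Require Import Defs.
From mathcomp Require Import boolp classical_sets reals.
From mathcomp Require Import all_boot all_order all_algebra all_fingroup all_solvable.
From mathcomp Require Import sesquilinear complex.

Set Implicit Arguments.
Unset Strict Implicit.
Unset Printing Implicit Defensive.

Import Order.TTheory GRing.Theory Num.Theory.
Local Open Scope ring_scope.

Section EndTrace.
Variables (F : fieldType) (V : vectType F).
Local Notation e := (vbasis {:V}).

Definition end_trace (f : 'End(V)) : F := \tr (passmx.mxof e e f).

Lemma end_traceE f : end_trace f = \sum_i coord e i (f e`_i).
Proof. by apply: eq_bigr => i _; rewrite !mxE /= passmx.vecof_delta. Qed.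

Lemma end_trace_sum (I : finType) (f : I -> 'End(V)) :
  end_trace (\sum_i f i) = \sum_i end_trace (f i).
Proof.
rewrite end_traceE; under eq_bigr do rewrite sum_lfunE linear_sum.
by rewrite exchange_big; apply: eq_bigr => i _; rewrite end_traceE.
Qed.

Lemma end_trace_scalar a : end_trace (a *: \1%VF) = a * (\dim {:V})%:R.
Proof.
rewrite end_traceE (eq_bigr (fun=> a)) ?sumr_const ?card_ord ?mulr_natr // => i _.
rewrite scale_lfunE id_lfunE linearZ /= coord_free ?(basis_free (vbasisP _)) //.
by rewrite eqxx mulr1.
Qed.

Lemma end_traceC f g : end_trace (f \o g)%VF = end_trace (g \o f)%VF.
Proof.
by rewrite /end_trace !(passmx.mxof_comp _ _ (vbasisP _)) mxtrace_mulC.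
Qed.

Lemma end_trace_rank1 (phi : {scalar V}) b (f : 'End(V)) :
  (forall x, f x = phi x *: b) -> end_trace f = phi b.
Proof.
move=> fE; rewrite end_traceE [in RHS](coord_vbasis (memvf b)) linear_sum /=.
by apply: eq_bigr => i _; rewrite fE !linearZ /= mulrC.
Qed.

End EndTrace.

Section SchurOrthogonality.
Variables (gT : finGroupType) (C : numClosedFieldType) (V : vectType C).
Variables (form : {dot V for Num.conj}) (rho : gT -> 'End(V)) (psi : gT -> C).
Hypotheses (rho_repr : is_representation rho) (rhoU : is_unitary_rep form rho).
Hypothesis rho_irr : is_irreducible rho.
Hypothesis rho_psi : is_central_character rho psi.
Local Notation Z := 'Z([set: gT])%g.
Local Notation "<< u | v >>" := (bracket form u v).

Lemma end_eigenvalue (f : 'End(V)) :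
  (0 < \dim {:V})%N -> exists a, passmx.leigenvalue f a.
Proof.
move=> V0; pose e := vbasis {:V}.
have [a fa] := eigenvalue_closed (passmx.mxof e e f) V0.
exists a; rewrite /passmx.leigenvalue (passmx.leigenspaceE (vbasisP _)).
by rewrite passmx.vsof_eq0 // vbasisP.
Qed.

Lemma schur_scalar (f : 'End(V)) :
  (forall g v, f (rho g v) = rho g (f v)) -> exists a, f = a *: \1%VF.
Proof.
move=> fC; case: rho_irr => V0 irr; have [a /negP fa] := end_eigenvalue f V0.
have eigP v : (v \in passmx.leigenspace f a) = (f v == a *: v).
  by rewrite memv_ker !lfun_simp subr_eq0.
exists a; apply/lfunP => v; rewrite !lfun_simp; apply/eqP; rewrite -eigP.
case: (irr (passmx.leigenspace f a)) => [g|/eqP//|->]; last exact: memvf.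
apply/subvP => _ /memv_imgP[u + ->]; rewrite !eigP => /eqP fu.
by rewrite fC fu linearZ.
Qed.

Lemma bracketC u v : <<u | v>> = <<v | u>>^*.
Proof. by rewrite /bracket hermC expr0 mul1r. Qed.

Lemma bracket_adjoint g u v : <<rho g u | v>> = <<u | rho g^-1%g v>>.
Proof.
by rewrite -(rhoU g u) -(rhoM rho_repr) mulgV rho_repr.1 id_lfunE.
Qed.

Definition rank1 (d b : V) : 'End(V) := linfun (fun x => <<d | x>> *: b).

Lemma rank1E d b x : rank1 d b x = <<d | x>> *: b.
Proof.
have lin : linear (fun x => <<d | x>> *: b).
  by move=> a u w; rewrite /bracket linearPl scalerDl scalerA.
pose h := GRing.isLinear.Build C V V _ _ lin.
pose f : {linear V -> V} := HB.pack (fun x => <<d | x>> *: b) h.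
exact: (lfunE f x).
Qed.

Lemma end_trace_rank1_bracket d b : end_trace (rank1 d b) = <<d | b>>.
Proof.
have lin : scalar (fun x => <<d | x>>) by move=> a u w; rewrite /bracket linearPl.
pose h := GRing.isLinear.Build C V C _ _ lin.
pose f : {scalar V} := HB.pack (fun x => <<d | x>>) h.
exact: (end_trace_rank1 (phi := f) (rank1E d b)).
Qed.

Definition conj_end (f : 'End(V)) g : 'End(V) := (rho g \o f \o rho g^-1%g)%VF.

Lemma conj_endM f g h : conj_end f (g * h)%g = conj_end (conj_end f h) g.
Proof.
by apply/lfunP => v; rewrite !comp_lfunE invMg !(rhoM rho_repr).
Qed.

Lemma conj_end_center f z : z \in Z -> conj_end f z = f.
Proof.
move=> zZ; apply/lfunP => v; rewrite !comp_lfunE (rho_psi zZ) scale_lfunE id_lfunE.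
rewrite -linearZ; have -> : psi z *: rho z^-1%g v = rho z (rho z^-1%g v).
  by rewrite (rho_psi zZ) scale_lfunE id_lfunE.
by rewrite -(rhoM rho_repr) mulgV rho_repr.1 id_lfunE.
Qed.

Lemma end_trace_conj f g : end_trace (conj_end f g) = end_trace f.
Proof.
rewrite /conj_end end_traceC; congr end_trace; apply/lfunP => v.
by rewrite !comp_lfunE -(rhoM rho_repr) mulVg rho_repr.1 id_lfunE.
Qed.

Lemma conj_end_lift f h c :
  conj_end f (lift_bar (coset Z h * c)%g) = conj_end f (h * lift_bar c)%g.
Proof.
have norm_Z x : x \in 'N(Z)%g.
  by apply: (subsetP (normal_norm (center_normal [set: gT]%G))); rewrite inE.
rewrite -{1}(lift_barK c) -morphM //=.
by have [z zZ ->] := lift_bar_coset (h * lift_bar c)%g; rewrite conj_endM conj_end_center.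
Qed.

Lemma sum_conj_end (f : 'End(V)) :
  \sum_c conj_end f (lift_bar c) =
    (#|{: Gbar gT}|%:R / (\dim {:V})%:R * end_trace f) *: \1%VF.
Proof.
set T := \sum_c _.
have TC h : conj_end T h = T.
  rewrite [RHS](reindex_inj (mulgI (coset Z h))) /=.
  under eq_bigr do rewrite conj_end_lift conj_endM.
  apply/lfunP => v; rewrite !comp_lfunE !sum_lfunE linear_sum /=.
  by apply: eq_bigr => c _; rewrite /conj_end !comp_lfunE.
have [g v|a Ta] := @schur_scalar T.
  rewrite -{1}(TC g) !comp_lfunE -(rhoM rho_repr).
  by rewrite mulVg rho_repr.1 id_lfunE.
have V0 : (\dim {:V})%:R != 0 :> C by rewrite pnatr_eq0 -lt0n rho_irr.1.
rewrite Ta; congr (_ *: _).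
have : end_trace T = #|{: Gbar gT}|%:R * end_trace f.
  rewrite end_trace_sum; under eq_bigr do rewrite end_trace_conj.
  by rewrite sumr_const mulr_natl.
rewrite Ta end_trace_scalar => e.
by apply: (mulIf V0); rewrite e mulrAC divfK.
Qed.

Lemma schur_orthogonality a b c d :
  \sum_(x : Gbar gT) <<a | rho (lift_bar x) b>> * <<rho (lift_bar x) d | c>> =
    #|{: Gbar gT}|%:R / (\dim {:V})%:R * <<d | b>> * <<a | c>>.
Proof.
have sumr (I : finType) (F : I -> V) : <<a | \sum_i F i>> = \sum_i <<a | F i>>.
  by rewrite /bracket linear_sumlz.
have Zr k u : <<a | k *: u>> = k * <<a | u>> by rewrite /bracket linearZl_LR.
rewrite -[<<d | b>>]end_trace_rank1_bracket -Zr.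
rewrite -[c in RHS]id_lfunE -scale_lfunE -sum_conj_end sum_lfunE sumr.
apply: eq_bigr => x _.
by rewrite !comp_lfunE rank1E linearZ /= Zr mulrC bracket_adjoint.
Qed.

(* [psi(delta(g, h)) v = rho(g h g^-1 h^-1) v], and [rho(g h g^-1)] moves to the
   left-hand argument by unitarity. *)
Lemma bracket_commutator c h v :
    delta_bar c (coset Z h) \in Z ->
  psi (delta_bar c (coset Z h)) * <<rho (lift_bar c) v | v>> =
  <<rho (lift_bar c) (rho h^-1%g v) | rho h^-1%g v>>.
Proof.
move=> dZ; have Zr k u w : <<u | k *: w>> = k * <<u | w>>.
  by rewrite /bracket linearZl_LR.
rewrite -Zr; have -> : psi (delta_bar c (coset Z h)) *: v =
    rho (delta_bar c (coset Z h)) v.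
  by rewrite rho_psi // scale_lfunE id_lfunE.
rewrite -[in delta_bar c _](lift_barK c) delta_bar_coset.
rewrite !bracket_adjoint -!(rhoM rho_repr) invgK.
by rewrite !mulgA mulVg mul1g.
Qed.

Lemma bouquet_angle_map Y : is_bouquet rho Y ->
  exists2 v, <<v | v>> = 1 &
    forall c, angle_map form rho Y c = `|<<v | rho (lift_bar c) v>>|.
Proof.
case=> l0 l0l YE; have l_line : is_line (xget 0%VS Y).
  case: xgetP => [l _|/(_ (line_act rho 1%g l0)) []].
    by rewrite YE => -[c _ <-]; exact: is_line_act.
  by rewrite YE; exists 1%g.
have [v vl v1] := line_unit form l_line; exists v => // c.
apply: angleE => //; [exact: is_line_act | exact: memv_img |by rewrite rhoU].
Qed.

End SchurOrthogonality.

Theorem theorem4p3 (R : realType) (gT : finGroupType) (V : vectType R[i])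
    (form : {dot V for Num.conj}) (rho : gT -> 'End(V)) (s : nat)
    (psi : gT -> R[i]) (Y : set {vspace V})
    (hnil : nilpotent [set: gT]) (hclass : (nil_class [set: gT] <= 2)%N)
    (hrho : is_representation rho) (hirr : is_irreducible rho)
    (hs : \dim {:V} = s)
    (hunit : is_unitary_rep form rho)
    (hpsi : is_central_character rho psi)
    (hY : is_bouquet rho Y) :
  angle_map_sq form rho Y != 0 /\
  Upsilon psi (angle_map_sq form rho Y) =
    (#|{: Gbar gT}|%:R / s%:R) *: angle_map_sq form rho Y.
Proof.
have [v v1 aE] := bouquet_angle_map hrho hunit hY.
split.
  apply/eqP => /ffunP /(_ 1%g); rewrite !ffunE aE => /eqP.
  rewrite sqrf_eq0 normr_eq0.
  have [z zZ] := lift_bar_coset (1%g : gT); rewrite morph1 mulg1 => ->.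
  rewrite (hpsi _ zZ) scale_lfunE id_lfunE /bracket linearZl_LR /=.
  rewrite [form v v]v1 mulr1; apply/negP; apply: (psi_neq0 hrho hpsi (v := v)) => //.
  by apply/eqP => v0; move/eqP: v1; rewrite v0 /bracket linear0l eq_sym oner_eq0.
apply/ffunP => c'; rewrite !ffunE -hs; set h := lift_bar c'.
pose w := rho h^-1%g v.
have wE : bracket form v w = (bracket form v (rho h v))^*.
  by rewrite -bracketC (bracket_adjoint hrho hunit).
transitivity (\sum_(c : Gbar gT)
    bracket form v (rho (lift_bar c) v) * bracket form (rho (lift_bar c) w) w).
  apply: eq_bigr => c _; rewrite !ffunE aE normCK -bracketC mulrCA.
  rewrite -{1}(lift_barK c') (bracket_commutator hrho hunit hpsi) //.
  exact: delta_bar_center.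
rewrite (schur_orthogonality hrho hunit hirr hpsi) aE -mulrA.
by rewrite (bracketC _ w) wE conjCK -normCK.
Qed.
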